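(* Let $f_1,f_2$ be nowhere zero smooth real-valued functions on $\mathbb{R}^2$ such that $f_1=f_1(x^1)$ depends only on $x^1$ and $f_2=f_2(x^2)$ depends only on $x^2$. Endow $\mathbb{R}^2$ with the Riemannian metric $g=\frac{1}{f_1^2}dx^1\otimes dx^1+\frac{1}{f_2^2}dx^2\otimes dx^2$ and let $E_1=f_1\frac{\partial}{\partial x^1}$, $E_2=f_2\frac{\partial}{\partial x^2}$. Let $V=V^1E_1+V^2E_2$ with $V^1,V^2$ smooth real-valued functions on $\mathbb{R}^2$. Then $V$ is a Ricci vector field satisfying $\nabla V=Q$ if and only if $V^1=c_1$ and $V^2=c_2$ for some constants $c_1,c_2\in\mathbb{R}$. In particular, the same equivalence holds if $f_1=k_1$ and $f_2=k_2$ are constants in $\mathbb{R}\setminus\{0\}$.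
   Context: $x^1,x^2$ are the standard coordinates on $\mathbb{R}^2$. $\nabla$ denotes the Levi-Civita connection of $g$, $\mathrm{Ric}$ its Ricci curvature tensor field, and $Q$ the Ricci operator defined by $g(QX_1,X_2)=\mathrm{Ric}(X_1,X_2)$ for all smooth vector fields $X_1,X_2$. A smooth vector field $V$ is a Ricci vector field satisfying $\nabla V=Q$ if $\nabla_XV=QX$ for all smooth vector fields $X$ on $\mathbb{R}^2$. *)

(* Defs.v *)
From Stdlib Require Import Reals.
From Coquelicot Require Import Coquelicot.
Open Scope R_scope.

(** Scalar fields on the plane, as functions of the standard coordinates
    [x^1], [x^2].  Smooth means that the iterated partial derivatives of all
    orders exist and are continuous everywhere. *)
Definition sfield := R -> R -> R.

Definition smooth (h : sfield) : Prop := forall n x1 x2, ex_diff_n h n x1 x2.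

Definition partial1 (h : sfield) : sfield :=
  fun x1 x2 => Derive (fun t => h t x2) x1.
Definition partial2 (h : sfield) : sfield :=
  fun x1 x2 => Derive (fun t => h x1 t) x2.

(** [VField a b] is a d/dx^1 + b d/dx^2. *)
Record vfield := VField { dx1 : sfield ; dx2 : sfield }.

Definition smooth_vf (X : vfield) : Prop := smooth (dx1 X) /\ smooth (dx2 X).

Definition ddx1 : vfield := VField (fun _ _ => 1) (fun _ _ => 0).
Definition ddx2 : vfield := VField (fun _ _ => 0) (fun _ _ => 1).

Definition vadd (X Y : vfield) : vfield :=
  VField (fun x1 x2 => dx1 X x1 x2 + dx1 Y x1 x2)
         (fun x1 x2 => dx2 X x1 x2 + dx2 Y x1 x2).
Definition vscal (h : sfield) (X : vfield) : vfield :=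
  VField (fun x1 x2 => h x1 x2 * dx1 X x1 x2)
         (fun x1 x2 => h x1 x2 * dx2 X x1 x2).
Definition vsub (X Y : vfield) : vfield :=
  VField (fun x1 x2 => dx1 X x1 x2 - dx1 Y x1 x2)
         (fun x1 x2 => dx2 X x1 x2 - dx2 Y x1 x2).

(** The derivative X(h). *)
Definition lie (X : vfield) (h : sfield) : sfield :=
  fun x1 x2 => dx1 X x1 x2 * partial1 h x1 x2 + dx2 X x1 x2 * partial2 h x1 x2.

Definition bracket (X Y : vfield) : vfield :=
  VField (fun x1 x2 => lie X (dx1 Y) x1 x2 - lie Y (dx1 X) x1 x2)
         (fun x1 x2 => lie X (dx2 Y) x1 x2 - lie Y (dx2 X) x1 x2).

(** Covariant 2-tensor fields, acting on pairs of vector fields. *)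
Definition tensor2 := vfield -> vfield -> sfield.

Definition tensor (a b : vfield -> sfield) : tensor2 :=
  fun X Y x1 x2 => a X x1 x2 * b Y x1 x2.

Definition metric (f1 f2 : sfield) : tensor2 :=
  fun X Y x1 x2 =>
    1 / (f1 x1 x2) ^ 2 * tensor dx1 dx1 X Y x1 x2 +
    1 / (f2 x1 x2) ^ 2 * tensor dx2 dx2 X Y x1 x2.

(** A connection is a map on all of [vfield], but only its values on smooth
    vector fields are constrained or used. *)
Definition affine_connection (nabla : vfield -> vfield -> vfield) : Prop :=
  (forall X Y, smooth_vf X -> smooth_vf Y -> smooth_vf (nabla X Y)) /\
  (forall X X' Y, smooth_vf X -> smooth_vf X' -> smooth_vf Y ->
     nabla (vadd X X') Y = vadd (nabla X Y) (nabla X' Y)) /\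
  (forall h X Y, smooth h -> smooth_vf X -> smooth_vf Y ->
     nabla (vscal h X) Y = vscal h (nabla X Y)) /\
  (forall X Y Y', smooth_vf X -> smooth_vf Y -> smooth_vf Y' ->
     nabla X (vadd Y Y') = vadd (nabla X Y) (nabla X Y')) /\
  (forall h X Y, smooth h -> smooth_vf X -> smooth_vf Y ->
     nabla X (vscal h Y) = vadd (vscal (lie X h) Y) (vscal h (nabla X Y))).

Definition torsion_free (nabla : vfield -> vfield -> vfield) : Prop :=
  forall X Y, smooth_vf X -> smooth_vf Y ->
    vsub (nabla X Y) (nabla Y X) = bracket X Y.

Definition metric_compatible (g : tensor2) (nabla : vfield -> vfield -> vfield) : Prop :=
  forall X Y Z, smooth_vf X -> smooth_vf Y -> smooth_vf Z ->
    forall x1 x2,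
      lie X (g Y Z) x1 x2 = g (nabla X Y) Z x1 x2 + g Y (nabla X Z) x1 x2.

Definition levi_civita (g : tensor2) (nabla : vfield -> vfield -> vfield) : Prop :=
  affine_connection nabla /\ torsion_free nabla /\ metric_compatible g nabla.

Definition curvature (nabla : vfield -> vfield -> vfield) (X Y Z : vfield) : vfield :=
  vsub (vsub (nabla X (nabla Y Z)) (nabla Y (nabla X Z))) (nabla (bracket X Y) Z).

(** Ric(Y,Z) is the trace of X |-> R(X,Y)Z, computed in the frame d/dx^1, d/dx^2. *)
Definition Ric (nabla : vfield -> vfield -> vfield) : tensor2 :=
  fun Y Z x1 x2 =>
    dx1 (curvature nabla ddx1 Y Z) x1 x2 + dx2 (curvature nabla ddx2 Y Z) x1 x2.

Definition ricci_operator (g : tensor2) (nabla : vfield -> vfield -> vfield)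
    (Q : vfield -> vfield) : Prop :=
  (forall X, smooth_vf X -> smooth_vf (Q X)) /\
  (forall X1 X2, smooth_vf X1 -> smooth_vf X2 ->
     forall x1 x2, g (Q X1) X2 x1 x2 = Ric nabla X1 X2 x1 x2).

Definition ricci_vector_field (nabla : vfield -> vfield -> vfield)
    (Q : vfield -> vfield) (V : vfield) : Prop :=
  smooth_vf V /\ forall X, smooth_vf X -> nabla X V = Q X.

(* Main.v *)
(** In the orthonormal frame [E_1, E_2] the coefficients [g(nabla_{E_i} E_j, E_k)]
    are symmetric in [i, j], because [[E_1, E_2] = 0], and antisymmetric in
    [j, k], because [g(E_j, E_k)] is constant; hence they vanish and the frame
    is parallel.  Therefore [R(X, Y) E_k = 0], so [Q = 0], while
    [nabla_X V = X(V^1) E_1 + X(V^2) E_2].  Thus [nabla V = Q] says exactly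
    that all partial derivatives of [V^1] and [V^2] vanish. *)
Require Import Defs.
From Stdlib Require Import Reals Lra FunctionalExtensionality.
From Coquelicot Require Import Coquelicot.
Open Scope R_scope.

(** * Extensional equality of scalar and vector fields *)

Lemma sfield_ext (h k : sfield) : (forall x1 x2, h x1 x2 = k x1 x2) -> h = k.
Proof.
intros H; apply functional_extensionality; intro x1.
apply functional_extensionality; intro x2; apply H.
Qed.

(** The axioms of a connection and the torsion identity are equalities of records of functions; this
    reduces them to pointwise real identities. *)
Lemma vfield_ext (X Y : vfield) :
  (forall x1 x2, dx1 X x1 x2 = dx1 Y x1 x2) ->
  (forall x1 x2, dx2 X x1 x2 = dx2 Y x1 x2) -> X = Y.
Proof.
destruct X as [a b], Y as [a' b']; simpl; intros H1 H2.
now rewrite (sfield_ext a a' H1), (sfield_ext b b' H2).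
Qed.

(** * Fields of class C^n on the whole plane and their closure properties *)

Definition diff_n (n : nat) (h : sfield) : Prop :=
  forall x1 x2, ex_diff_n h n x1 x2.

(** Quantifying over all points turns the pointwise recursion of [ex_diff_n] into a recursion on
    whole fields. In the inductions below, [partial1] and [partial2] of a compound field can then be
    rewritten by the usual differentiation rules. *)
Lemma diff_n_S (n : nat) (h : sfield) :
  diff_n (S n) h <->
  (forall x1 x2, continuity_2d_pt h x1 x2) /\
  (forall x1 x2, ex_derive (fun t => h t x2) x1) /\
  (forall x1 x2, ex_derive (fun t => h x1 t) x2) /\
  diff_n n (partial1 h) /\ diff_n n (partial2 h).
Proof.
unfold diff_n; simpl; split.
- intros H; repeat split; intros x1 x2; apply (H x1 x2).
- intros (Hc & H1 & H2 & H3 & H4) x1 x2; repeat split;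
    [apply Hc | apply H1 | apply H2 | apply H3 | apply H4].
Qed.

Lemma diff_n_pred (n : nat) (h : sfield) : diff_n (S n) h -> diff_n n h.
Proof.
intros H x1 x2; apply (ex_diff_n_m (S n)); [auto with arith | apply H].
Qed.

Lemma diff_n_const (n : nat) (c : R) : diff_n n (fun _ _ => c).
Proof.
revert c; induction n as [|n IH]; intro c.
- intros x1 x2; split; [apply continuity_2d_pt_const | exact I].
- assert (D1 : partial1 (fun _ _ => c) = fun _ _ => 0)
    by (apply sfield_ext; intros x1 x2; exact (Derive_const c x1)).
  assert (D2 : partial2 (fun _ _ => c) = fun _ _ => 0)
    by (apply sfield_ext; intros x1 x2; exact (Derive_const c x2)).
  apply diff_n_S; rewrite D1, D2; repeat split; try apply IH; intros.
  + apply continuity_2d_pt_const.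
  + apply ex_derive_const.
  + apply ex_derive_const.
Qed.

Lemma diff_n_plus (n : nat) (h k : sfield) : diff_n n h -> diff_n n k ->
  diff_n n (fun x1 x2 => h x1 x2 + k x1 x2).
Proof.
revert h k; induction n as [|n IH]; intros h k Hh Hk.
- intros x1 x2; split; [|exact I].
  apply continuity_2d_pt_plus; [apply Hh | apply Hk].
- apply diff_n_S in Hh; destruct Hh as (Hc & H1 & H2 & H3 & H4).
  apply diff_n_S in Hk; destruct Hk as (Kc & K1 & K2 & K3 & K4).
  assert (D1 : partial1 (fun x1 x2 => h x1 x2 + k x1 x2)
               = fun x1 x2 => partial1 h x1 x2 + partial1 k x1 x2).
  { apply sfield_ext; intros x1 x2.
    exact (Derive_plus (fun t => h t x2) (fun t => k t x2) x1
             (H1 x1 x2) (K1 x1 x2)). }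
  assert (D2 : partial2 (fun x1 x2 => h x1 x2 + k x1 x2)
               = fun x1 x2 => partial2 h x1 x2 + partial2 k x1 x2).
  { apply sfield_ext; intros x1 x2.
    exact (Derive_plus (fun t => h x1 t) (fun t => k x1 t) x2
             (H2 x1 x2) (K2 x1 x2)). }
  apply diff_n_S; rewrite D1, D2; repeat split; try (apply IH; assumption); intros.
  + apply continuity_2d_pt_plus; auto.
  + apply (ex_derive_plus (fun t => h t x2) (fun t => k t x2)); auto.
  + apply (ex_derive_plus (fun t => h x1 t) (fun t => k x1 t)); auto.
Qed.

Lemma diff_n_mult (n : nat) (h k : sfield) : diff_n n h -> diff_n n k ->
  diff_n n (fun x1 x2 => h x1 x2 * k x1 x2).
Proof.
revert h k; induction n as [|n IH]; intros h k Hh Hk.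
- intros x1 x2; split; [|exact I].
  apply continuity_2d_pt_mult; [apply Hh | apply Hk].
(* The Leibniz rule leaves undifferentiated factors [h] and [k] in the partial derivatives, so the
   induction hypothesis needs these at order [n] too. *)
- assert (Hh' := diff_n_pred _ _ Hh); assert (Hk' := diff_n_pred _ _ Hk).
  apply diff_n_S in Hh; destruct Hh as (Hc & H1 & H2 & H3 & H4).
  apply diff_n_S in Hk; destruct Hk as (Kc & K1 & K2 & K3 & K4).
  assert (D1 : partial1 (fun x1 x2 => h x1 x2 * k x1 x2)
               = fun x1 x2 => partial1 h x1 x2 * k x1 x2 + h x1 x2 * partial1 k x1 x2).
  { apply sfield_ext; intros x1 x2.
    exact (Derive_mult (fun t => h t x2) (fun t => k t x2) x1
             (H1 x1 x2) (K1 x1 x2)). }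
  assert (D2 : partial2 (fun x1 x2 => h x1 x2 * k x1 x2)
               = fun x1 x2 => partial2 h x1 x2 * k x1 x2 + h x1 x2 * partial2 k x1 x2).
  { apply sfield_ext; intros x1 x2.
    exact (Derive_mult (fun t => h x1 t) (fun t => k x1 t) x2
             (H2 x1 x2) (K2 x1 x2)). }
  apply diff_n_S; rewrite D1, D2; repeat split;
    try (apply diff_n_plus; apply IH; assumption); intros.
  + apply continuity_2d_pt_mult; auto.
  + apply (ex_derive_mult (fun t => h t x2) (fun t => k t x2)); auto.
  + apply (ex_derive_mult (fun t => h x1 t) (fun t => k x1 t)); auto.
Qed.

(** * Smooth functions and smooth vector fields *)

Lemma smooth_const (c : R) : smooth (fun _ _ => c).
Proof. intro n; apply diff_n_const. Qed.

Lemma smooth_plus (h k : sfield) : smooth h -> smooth k ->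
  smooth (fun x1 x2 => h x1 x2 + k x1 x2).
Proof. intros Hh Hk n; exact (diff_n_plus n h k (Hh n) (Hk n)). Qed.

Lemma smooth_mult (h k : sfield) : smooth h -> smooth k ->
  smooth (fun x1 x2 => h x1 x2 * k x1 x2).
Proof. intros Hh Hk n; exact (diff_n_mult n h k (Hh n) (Hk n)). Qed.

Lemma smooth_minus (h k : sfield) : smooth h -> smooth k ->
  smooth (fun x1 x2 => h x1 x2 - k x1 x2).
Proof.
intros Hh Hk.
replace (fun x1 x2 => h x1 x2 - k x1 x2)
  with (fun x1 x2 => h x1 x2 + (-1) * k x1 x2)
  by (apply sfield_ext; intros; ring).
apply smooth_plus; [assumption|].
apply (smooth_mult (fun _ _ => -1)); [apply smooth_const | assumption].
Qed.

Lemma smooth_partial1 (h : sfield) : smooth h -> smooth (partial1 h).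
Proof. intros H n; exact (proj1 (proj2 (proj2 (proj2 (proj1 (diff_n_S n h) (H (S n))))))). Qed.

Lemma smooth_partial2 (h : sfield) : smooth h -> smooth (partial2 h).
Proof. intros H n; exact (proj2 (proj2 (proj2 (proj2 (proj1 (diff_n_S n h) (H (S n))))))). Qed.

Lemma smooth_ex_derive1 (h : sfield) (x1 x2 : R) :
  smooth h -> ex_derive (fun t => h t x2) x1.
Proof. intros H; apply (H 1%nat x1 x2). Qed.

Lemma smooth_ex_derive2 (h : sfield) (x1 x2 : R) :
  smooth h -> ex_derive (fun t => h x1 t) x2.
Proof. intros H; apply (H 1%nat x1 x2). Qed.

Lemma smooth_lie (X : vfield) (h : sfield) :
  smooth_vf X -> smooth h -> smooth (lie X h).
Proof.
intros [HX1 HX2] Hh; apply smooth_plus; apply smooth_mult; trivial.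
- now apply smooth_partial1.
- now apply smooth_partial2.
Qed.

Lemma smooth_vf_ddx1 : smooth_vf ddx1.
Proof. split; [exact (smooth_const 1) | exact (smooth_const 0)]. Qed.

Lemma smooth_vf_ddx2 : smooth_vf ddx2.
Proof. split; [exact (smooth_const 0) | exact (smooth_const 1)]. Qed.

Lemma smooth_vadd (X Y : vfield) :
  smooth_vf X -> smooth_vf Y -> smooth_vf (vadd X Y).
Proof. intros [? ?] [? ?]; split; apply smooth_plus; assumption. Qed.

Lemma smooth_vscal (h : sfield) (X : vfield) :
  smooth h -> smooth_vf X -> smooth_vf (vscal h X).
Proof. intros ? [? ?]; split; apply smooth_mult; assumption. Qed.

Lemma smooth_bracket (X Y : vfield) :
  smooth_vf X -> smooth_vf Y -> smooth_vf (bracket X Y).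
Proof.
intros HX HY; split; apply smooth_minus; apply smooth_lie; trivial;
  try apply HX; apply HY.
Qed.

(** * Constancy and vanishing derivatives *)

Lemma partial1_const (h : sfield) (x1 x2 : R) :
  (forall x1 x1' x2, h x1 x2 = h x1' x2) -> partial1 h x1 x2 = 0.
Proof.
intros H; unfold partial1.
rewrite (Derive_ext _ (fun _ => h 0 x2)) by (intro; apply H).
apply Derive_const.
Qed.

Lemma partial2_const (h : sfield) (x1 x2 : R) :
  (forall x1 x2 x2', h x1 x2 = h x1 x2') -> partial2 h x1 x2 = 0.
Proof.
intros H; unfold partial2.
rewrite (Derive_ext _ (fun _ => h x1 0)) by (intro; apply H).
apply Derive_const.
Qed.

Lemma lie_const (X : vfield) (h : sfield) (c x1 x2 : R) :
  (forall x1 x2, h x1 x2 = c) -> lie X h x1 x2 = 0.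
Proof.
intros H; unfold lie.
rewrite partial1_const, partial2_const by (intros; rewrite !H; reflexivity).
ring.
Qed.

Lemma Derive_zero_const (u : R -> R) :
  (forall t, ex_derive u t) -> (forall t, Derive u t = 0) ->
  forall s t, u s = u t.
Proof.
intros Hex H0 s t.
(* This form of the mean value theorem does not order its endpoints, so no case distinction on [s]
   and [t] arises. *)
destruct (MVT_gen u s t (Derive u)) as [c [_ Hc]].
- intros x _; apply Derive_correct, Hex.
- intros x _; apply continuity_pt_filterlim.
  apply (ex_derive_continuous u), Hex.
- rewrite H0 in Hc; lra.
Qed.

(** Any point is joined to the origin by a horizontal segment to (0, x2) followed by a vertical one,
    and [h] is constant along each. *)
Lemma partial_zero_const (h : sfield) : smooth h ->
  (forall x1 x2, partial1 h x1 x2 = 0) -> (forall x1 x2, partial2 h x1 x2 = 0) ->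
  forall x1 x2, h x1 x2 = h 0 0.
Proof.
intros Hh H1 H2 x1 x2; transitivity (h 0 x2).
- apply (Derive_zero_const (fun t => h t x2)); intro t;
    [now apply smooth_ex_derive1 | apply H1].
- apply (Derive_zero_const (fun t => h 0 t)); intro t;
    [now apply smooth_ex_derive2 | apply H2].
Qed.

(** * The zero field, and curvature applied to parallel fields *)

Definition vzero : vfield := VField (fun _ _ => 0) (fun _ _ => 0).

Lemma smooth_vzero : smooth_vf vzero.
Proof. split; exact (smooth_const 0). Qed.

Lemma vscal_0 (X : vfield) : vscal (fun _ _ => 0) X = vzero.
Proof. apply vfield_ext; simpl; intros; ring. Qed.

(** Cancels the factors [f1] and [f2] when passing from the orthonormal frame to the coordinate
    frame, with no appeal to smoothness of their reciprocals. *)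
Lemma vscal_eq0 (h : sfield) (X : vfield) :
  (forall x1 x2, h x1 x2 <> 0) -> vscal h X = vzero -> X = vzero.
Proof.
intros Hh H; apply vfield_ext; intros x1 x2; simpl.
- assert (H1 : dx1 (vscal h X) x1 x2 = 0) by now rewrite H.
  destruct (Rmult_integral _ _ H1); [now destruct (Hh x1 x2) | assumption].
- assert (H1 : dx2 (vscal h X) x1 x2 = 0) by now rewrite H.
  destruct (Rmult_integral _ _ H1); [now destruct (Hh x1 x2) | assumption].
Qed.

Lemma nabla_vzero (nabla : vfield -> vfield -> vfield) (X : vfield) :
  affine_connection nabla -> smooth_vf X -> nabla X vzero = vzero.
Proof.
intros (_ & _ & _ & _ & Hleib) HX.
(* Writing 0 as 0 * 0 brings in the Leibniz rule: one resulting term is a multiple of the zero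
   field, the other has the factor 0. *)
rewrite <- (vscal_0 vzero) at 1.
rewrite Hleib; [|apply smooth_const|assumption|apply smooth_vzero].
apply vfield_ext; simpl; intros; ring.
Qed.

(** The first two terms of the curvature differentiate the zero field; the third is a derivative of
    [Z] along the smooth field [X, Y]. *)
Lemma curvature_parallel (nabla : vfield -> vfield -> vfield) (X Y Z : vfield) :
  affine_connection nabla -> smooth_vf X -> smooth_vf Y ->
  (forall W, smooth_vf W -> nabla W Z = vzero) ->
  curvature nabla X Y Z = vzero.
Proof.
intros Haff HX HY HZ; unfold curvature.
assert (HXY := smooth_bracket _ _ HX HY).
rewrite !HZ, !(nabla_vzero nabla) by assumption.
apply vfield_ext; simpl; intros; ring.
Qed.

(** * The separated metric and its orthonormal frame *)

Section SeparatedMetric.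

Variables f1 f2 : sfield.
Hypothesis (f1_smooth : smooth f1) (f2_smooth : smooth f2).
Hypothesis f1_neq0 : forall x1 x2, f1 x1 x2 <> 0.
Hypothesis f2_neq0 : forall x1 x2, f2 x1 x2 <> 0.
Hypothesis f1_sep : forall x1 x2 x2', f1 x1 x2 = f1 x1 x2'.
Hypothesis f2_sep : forall x1 x1' x2, f2 x1 x2 = f2 x1' x2.

Let g := metric f1 f2.
Let E1 := vscal f1 ddx1.
Let E2 := vscal f2 ddx2.

Lemma smooth_frame1 : smooth_vf E1.
Proof. apply smooth_vscal; [assumption | apply smooth_vf_ddx1]. Qed.

Lemma smooth_frame2 : smooth_vf E2.
Proof. apply smooth_vscal; [assumption | apply smooth_vf_ddx2]. Qed.

(** The right-hand side is the coefficient of [X] along [E1], since d/dx^1 is [E1] divided by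
    [f1]. *)
Lemma metric_frame1 (X : vfield) (x1 x2 : R) :
  g X E1 x1 x2 = dx1 X x1 x2 / f1 x1 x2.
Proof. unfold g, E1, metric, tensor; simpl; field; auto. Qed.

Lemma metric_frame2 (X : vfield) (x1 x2 : R) :
  g X E2 x1 x2 = dx2 X x1 x2 / f2 x1 x2.
Proof. unfold g, E2, metric, tensor; simpl; field; auto. Qed.

Lemma metric_sym (X Y : vfield) (x1 x2 : R) : g X Y x1 x2 = g Y X x1 x2.
Proof. unfold g, metric, tensor; ring. Qed.

Lemma metric_frame_eq0 (X : vfield) :
  (forall x1 x2, g X E1 x1 x2 = 0) -> (forall x1 x2, g X E2 x1 x2 = 0) ->
  X = vzero.
Proof.
intros H1 H2; apply vfield_ext; intros x1 x2; simpl.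
- specialize (H1 x1 x2); rewrite metric_frame1 in H1.
  replace (dx1 X x1 x2) with (dx1 X x1 x2 / f1 x1 x2 * f1 x1 x2) by (field; auto).
  rewrite H1; ring.
- specialize (H2 x1 x2); rewrite metric_frame2 in H2.
  replace (dx2 X x1 x2) with (dx2 X x1 x2 / f2 x1 x2 * f2 x1 x2) by (field; auto).
  rewrite H2; ring.
Qed.

(** The bracket is f1 (d f2/dx^1) d/dx^2 - f2 (d f1/dx^2) d/dx^1, and separation of variables makes
    both derivatives vanish. *)
Lemma bracket_frame : bracket E1 E2 = vzero.
Proof.
assert (Z1 : dx1 E2 = fun _ _ => 0) by (apply sfield_ext; intros; simpl; ring).
assert (Z2 : dx2 E1 = fun _ _ => 0) by (apply sfield_ext; intros; simpl; ring).
assert (P1 : dx1 E1 = f1) by (apply sfield_ext; intros; simpl; ring).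
assert (P2 : dx2 E2 = f2) by (apply sfield_ext; intros; simpl; ring).
apply vfield_ext; intros x1 x2; unfold bracket, lie; cbn [dx1 dx2 vzero];
  rewrite Z1, Z2, P1, P2.
- rewrite (partial2_const f1), (partial1_const (fun _ _ => 0)) by auto; ring.
- rewrite (partial1_const f2), (partial2_const (fun _ _ => 0)) by auto; ring.
Qed.

(** * Parallelism of the frame for the Levi-Civita connection *)

Variables (nabla : vfield -> vfield -> vfield) (Q : vfield -> vfield).
Hypothesis LC : levi_civita g nabla.

Lemma nabla_frame :
  nabla E1 E1 = vzero /\ nabla E1 E2 = vzero /\
  nabla E2 E1 = vzero /\ nabla E2 E2 = vzero.
Proof.
destruct LC as (_ & Htor & Hmet).
assert (S1 := smooth_frame1); assert (S2 := smooth_frame2).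
assert (H12 : nabla E1 E2 = nabla E2 E1).
{ assert (T := Htor _ _ S1 S2); rewrite bracket_frame in T.
  apply vfield_ext; intros x1 x2.
  - assert (T1 : dx1 (vsub (nabla E1 E2) (nabla E2 E1)) x1 x2 = 0) by now rewrite T.
    simpl in T1; lra.
  - assert (T2 : dx2 (vsub (nabla E1 E2) (nabla E2 E1)) x1 x2 = 0) by now rewrite T.
    simpl in T2; lra. }
(* Differentiating the constant g(E1, E1) = 1 gives twice this coefficient; [C22] is the analogue
   for [E2], and [C12] comes from g(E1, E2) = 0. *)
assert (C11 : forall X, smooth_vf X -> forall x1 x2, g (nabla X E1) E1 x1 x2 = 0).
{ intros X HX x1 x2; assert (M := Hmet _ _ _ HX S1 S1 x1 x2).
  rewrite (lie_const _ _ 1), (metric_sym E1) in M; [lra|].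
  intros; rewrite metric_frame1; simpl; field; auto. }
assert (C22 : forall X, smooth_vf X -> forall x1 x2, g (nabla X E2) E2 x1 x2 = 0).
{ intros X HX x1 x2; assert (M := Hmet _ _ _ HX S2 S2 x1 x2).
  rewrite (lie_const _ _ 1), (metric_sym E2) in M; [lra|].
  intros; rewrite metric_frame2; simpl; field; auto. }
assert (C12 : forall X, smooth_vf X -> forall x1 x2,
  g (nabla X E1) E2 x1 x2 = - g (nabla X E2) E1 x1 x2).
{ intros X HX x1 x2; assert (M := Hmet _ _ _ HX S1 S2 x1 x2).
  rewrite (lie_const _ _ 0), (metric_sym E1) in M; [lra|].
  intros; rewrite metric_frame2; simpl; field; auto. }
(* There are eight coefficients, two for each covariant derivative. Those whose last two indices
   agree vanish by [C11] or [C22]; the others are brought to that form by the symmetry [H12],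
   preceded by the antisymmetry [C12] when the first two indices agree. *)
repeat split; apply metric_frame_eq0; intros x1 x2.
- now apply C11.
- now rewrite C12, H12, C11 by assumption; ring.
- now rewrite H12; apply C11.
- now apply C22.
- now apply C11.
- now rewrite <- H12; apply C22.
- now assert (H := C12 E2 S2 x1 x2); rewrite <- H12, C22 in H by assumption; lra.
- now apply C22.
Qed.

(** Linearity over functions in the direction slot. The expansion of [W] uses the coordinate frame,
    where its coefficients are smooth by assumption; in the orthonormal frame they would be
    quotients by [f1] and [f2]. *)
Lemma nabla_eq0_of_frame (Z : vfield) : smooth_vf Z ->
  nabla E1 Z = vzero -> nabla E2 Z = vzero ->
  forall W, smooth_vf W -> nabla W Z = vzero.
Proof.
intros HZ H1 H2 W HW; destruct LC as ((_ & Hadd & Hscal & _) & _).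
assert (S1 := smooth_vf_ddx1); assert (S2 := smooth_vf_ddx2).
assert (D1 : nabla ddx1 Z = vzero).
{ apply (vscal_eq0 f1); [assumption|]. rewrite <- Hscal by assumption. exact H1. }
assert (D2 : nabla ddx2 Z = vzero).
{ apply (vscal_eq0 f2); [assumption|]. rewrite <- Hscal by assumption. exact H2. }
assert (EW : W = vadd (vscal (dx1 W) ddx1) (vscal (dx2 W) ddx2))
  by (apply vfield_ext; simpl; intros; ring).
destruct HW as [HW1 HW2].
rewrite EW, Hadd, !Hscal, D1, D2 by auto using smooth_vscal.
apply vfield_ext; simpl; intros; ring.
Qed.

Lemma frame1_parallel (W : vfield) : smooth_vf W -> nabla W E1 = vzero.
Proof.
apply nabla_eq0_of_frame; [apply smooth_frame1 | apply nabla_frame | apply nabla_frame].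
Qed.

Lemma frame2_parallel (W : vfield) : smooth_vf W -> nabla W E2 = vzero.
Proof.
apply nabla_eq0_of_frame; [apply smooth_frame2 | apply nabla_frame | apply nabla_frame].
Qed.

(** The parallel field occupies the slot on which the curvature endomorphism acts, so both terms of
    the trace vanish. *)
Lemma Ric_parallel (X Z : vfield) : smooth_vf X ->
  (forall W, smooth_vf W -> nabla W Z = vzero) ->
  forall x1 x2, Ric nabla X Z x1 x2 = 0.
Proof.
intros HX HZ x1 x2; unfold Ric.
rewrite !curvature_parallel
  by (auto using smooth_vf_ddx1, smooth_vf_ddx2; apply LC).
simpl; ring.
Qed.

(** * Vanishing of the Ricci operator and the Ricci vector fields *)

Hypothesis HQ : ricci_operator g nabla Q.

Lemma ricci_operator_eq0 (X : vfield) : smooth_vf X -> Q X = vzero.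
Proof.
intros HX; destruct HQ as [_ Hg]; apply metric_frame_eq0; intros x1 x2.
- rewrite Hg by auto using smooth_frame1.
  apply Ric_parallel; [assumption | apply frame1_parallel].
- rewrite Hg by auto using smooth_frame2.
  apply Ric_parallel; [assumption | apply frame2_parallel].
Qed.

(** In the Leibniz rule only the terms differentiating the coefficients survive, because the frame
    is parallel. *)
Lemma nabla_frame_combination (V1 V2 : sfield) (X : vfield) :
  smooth V1 -> smooth V2 -> smooth_vf X ->
  nabla X (vadd (vscal V1 E1) (vscal V2 E2)) =
  vadd (vscal (lie X V1) E1) (vscal (lie X V2) E2).
Proof.
intros HV1 HV2 HX; destruct LC as ((_ & _ & _ & Hadd & Hleib) & _).
assert (S1 := smooth_frame1); assert (S2 := smooth_frame2).
rewrite Hadd, !Hleib, frame1_parallel, frame2_parallel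
  by auto using smooth_vscal.
apply vfield_ext; simpl; intros; ring.
Qed.

Lemma ricci_vector_field_iff_const (V1 V2 : sfield) : smooth V1 -> smooth V2 ->
  ricci_vector_field nabla Q (vadd (vscal V1 E1) (vscal V2 E2)) <->
  exists c1 c2 : R,
    (forall x1 x2, V1 x1 x2 = c1) /\ (forall x1 x2, V2 x1 x2 = c2).
Proof.
intros HV1 HV2; split.
- intros [_ H].
  assert (HL : forall X, smooth_vf X -> forall x1 x2,
            lie X V1 x1 x2 = 0 /\ lie X V2 x1 x2 = 0).
  { intros X HX x1 x2; specialize (H X HX).
    rewrite ricci_operator_eq0, nabla_frame_combination in H by assumption.
    (* [H] now says X(V^1) E1 + X(V^2) E2 = 0; pairing with each frame field isolates one
       coefficient. *)
    assert (A1 := f_equal (fun Y => g Y E1 x1 x2) H).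
    assert (A2 := f_equal (fun Y => g Y E2 x1 x2) H).
    cbv beta in A1, A2.
    rewrite !metric_frame1 in A1; rewrite !metric_frame2 in A2; simpl in A1, A2.
    split.
    - transitivity ((lie X V1 x1 x2 * (f1 x1 x2 * 1)
                     + lie X V2 x1 x2 * (f2 x1 x2 * 0)) / f1 x1 x2);
        [field; auto | rewrite A1; field; auto].
    - transitivity ((lie X V1 x1 x2 * (f1 x1 x2 * 0)
                     + lie X V2 x1 x2 * (f2 x1 x2 * 1)) / f2 x1 x2);
        [field; auto | rewrite A2; field; auto]. }
  (* Taking the coordinate fields for X turns the vanishing of X(V^i) into the vanishing of all
     partial derivatives; the constants are then the values at the origin. *)
  assert (L1 := HL _ smooth_vf_ddx1); assert (L2 := HL _ smooth_vf_ddx2).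
  unfold lie in L1, L2; simpl in L1, L2.
  exists (V1 0 0), (V2 0 0); split; apply partial_zero_const; trivial;
    intros x1 x2; specialize (L1 x1 x2); specialize (L2 x1 x2); lra.
- intros (c1 & c2 & H1 & H2); split.
  + auto using smooth_vadd, smooth_vscal, smooth_frame1, smooth_frame2.
  + intros X HX; rewrite ricci_operator_eq0, nabla_frame_combination by assumption.
    apply vfield_ext; intros x1 x2; simpl;
      rewrite (lie_const X V1 c1), (lie_const X V2 c2) by assumption; ring.
Qed.

End SeparatedMetric.

Theorem theorem2p4 :
  (forall f1 f2 : sfield,
     smooth f1 -> smooth f2 ->
     (forall x1 x2, f1 x1 x2 <> 0) -> (forall x1 x2, f2 x1 x2 <> 0) ->
     (forall x1 x2 x2', f1 x1 x2 = f1 x1 x2') ->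
     (forall x1 x1' x2, f2 x1 x2 = f2 x1' x2) ->
     let g := metric f1 f2 in
     let E1 := vscal f1 ddx1 in
     let E2 := vscal f2 ddx2 in
     forall (nabla : vfield -> vfield -> vfield) (Q : vfield -> vfield),
     levi_civita g nabla -> ricci_operator g nabla Q ->
     forall V1 V2 : sfield, smooth V1 -> smooth V2 ->
     let V := vadd (vscal V1 E1) (vscal V2 E2) in
     ricci_vector_field nabla Q V <->
     exists c1 c2 : R,
       (forall x1 x2, V1 x1 x2 = c1) /\ (forall x1 x2, V2 x1 x2 = c2))
  /\
  (forall k1 k2 : R, k1 <> 0 -> k2 <> 0 ->
     let f1 : sfield := fun _ _ => k1 in
     let f2 : sfield := fun _ _ => k2 in
     let g := metric f1 f2 in
     let E1 := vscal f1 ddx1 in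
     let E2 := vscal f2 ddx2 in
     forall (nabla : vfield -> vfield -> vfield) (Q : vfield -> vfield),
     levi_civita g nabla -> ricci_operator g nabla Q ->
     forall V1 V2 : sfield, smooth V1 -> smooth V2 ->
     let V := vadd (vscal V1 E1) (vscal V2 E2) in
     ricci_vector_field nabla Q V <->
     exists c1 c2 : R,
       (forall x1 x2, V1 x1 x2 = c1) /\ (forall x1 x2, V2 x1 x2 = c2)).
Proof.
split.
- intros; now apply ricci_vector_field_iff_const.
- intros k1 k2 Hk1 Hk2; intros.
  (* Nonzero constants satisfy the separation and nonvanishing hypotheses immediately, which leaves
     only their smoothness. *)
  apply ricci_vector_field_iff_const; trivial;
    [exact (smooth_const k1) | exact (smooth_const k2)].
Qed.
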